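(* Let $G$ be a graph on $n \geq 1$ vertices. For any natural number $k > 5n^2$, the colouring graph $\mathcal{C}_k(G)$ uniquely determines $G$ up to isomorphism; that is, for every graph $G'$ with $\mathcal{C}_k(G') \cong \mathcal{C}_k(G)$ we have $G' \cong G$.
   Context: All graphs are finite and simple, with at least one vertex. For a positive integer $k$, a $k$-colouring of a graph $G$ is a proper colouring $c\colon V(G)\to [k]=\{1,\dots,k\}$, i.e. $c(u)\neq c(v)$ whenever $uv\in E(G)$ (not all $k$ colours need be used). The $k$-colouring graph $\mathcal{C}_k(G)$ has as vertices the $k$-colourings of $G$, with an edge between two $k$-colourings if and only if they differ at precisely one vertex of $G$. *)

(* Defs.v *)
From mathcomp Require Import all_boot.

Set Implicit Arguments.
Unset Strict Implicit.
Unset Printing Implicit Defensive.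

(* The vertex set may be empty here: nonemptiness is a separate hypothesis
   wherever it is needed. *)
Record sgraph := SGraph {
  vertex :> finType;
  adj : rel vertex;
  adj_sym : symmetric adj;
  adj_irrefl : irreflexive adj
}.

Definition graph_iso (G H : sgraph) : Prop :=
  exists2 f : G -> H, bijective f & forall u v : G, adj (f u) (f v) = adj u v.

(* The colour set {1, ..., k} is represented by 'I_k = {0, ..., k - 1}. *)
Definition proper_colouring (G : sgraph) (k : nat) (c : {ffun G -> 'I_k}) : bool :=
  [forall u, forall v, adj u v ==> (c u != c v)].

Definition colouring (G : sgraph) (k : nat) : finType :=
  {c : {ffun G -> 'I_k} | proper_colouring c}.

Definition colouring_adj (G : sgraph) (k : nat) : rel (colouring G k) :=
  fun c d => #|[set v : G | val c v != val d v]| == 1.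

Lemma colouring_adj_sym (G : sgraph) (k : nat) : symmetric (@colouring_adj G k).
Proof.
move=> c d; rewrite /colouring_adj; congr (_ == 1).
by apply: eq_card => v; rewrite !inE eq_sym.
Qed.

Lemma colouring_adj_irrefl (G : sgraph) (k : nat) :
  irreflexive (@colouring_adj G k).
Proof.
move=> c; rewrite /colouring_adj (_ : [set v | _] = set0) ?cards0 //.
by apply/setP => v; rewrite !inE eqxx.
Qed.

Definition colouring_graph (G : sgraph) (k : nat) : sgraph :=
  SGraph (@colouring_adj_sym G k) (@colouring_adj_irrefl G k).

(* Main.v *)
Require Import Defs.
From mathcomp Require Import all_boot.
From mathcomp Require Import perm zify.

Set Implicit Arguments.
Unset Strict Implicit.
Unset Printing Implicit Defensive.

(** The neighbours of a colouring [c] in the colouring graph are partitioned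
    according to the vertex they recolour, and two of them recolour the same
    vertex iff they are equal or adjacent.  If [x] and [y] recolour distinct
    vertices [u] and [v], the only possible common neighbour other than [c]
    recolours both; it is missing exactly when [u] and [v] are adjacent and
    receive the same new colour.  Hence, as soon as no vertex is frozen at [c]
    and some colour is not used by [c], the ball around [c] determines the graph.

    It remains to see that [G'], whose order is not known to be small, has no
    frozen vertex.  Every edge of [C_k(G)] lies in a triangle, so a vertex of [G']
    which is not frozen has two alternative colours, and recolouring another
    vertex leaves one of them available.  Frozen vertices therefore stay frozen,
    and keep their colour, along each connected component; but [C_k(G)] is
    connected, while permuting colours changes the colour of any given vertex. *)

Lemma exists_notin (T : finType) (A : {set T}) :
  #|A| < #|T| -> exists a, a \notin A.
Proof.
move=> ltA; have : 0 < #|~: A| by have := cardsC A; lia.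
by case/card_gt0P=> a; rewrite inE; exists a.
Qed.

Lemma exists_injection_notin (T U : finType) (A : {set U}) :
  #|A| + #|T| <= #|U| ->
  exists2 f : T -> U, injective f & forall t, f t \notin A.
Proof.
move=> leAT; have leTA : #|T| <= #|~: A| by have := cardsC A; lia.
exists (fun t => enum_val (widen_ord leTA (enum_rank t))).
  by move=> s t /enum_val_inj /(congr1 val) /= /val_inj /enum_rank_inj.
by move=> t; have := enum_valP (widen_ord leTA (enum_rank t)); rewrite inE.
Qed.

(** * Recolouring a single vertex *)

Section Recolouring.

Variables (G : sgraph) (k : nat).
Implicit Types (c d x y z : colouring G k) (u v w : G) (a b : 'I_k).

Lemma proper_colouringP (c : {ffun G -> 'I_k}) :
  reflect (forall u v, adj u v -> c u != c v) (proper_colouring c).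
Proof.
apply: (iffP forallP) => [c_ok u v|c_ok u].
  by have /forallP/(_ v)/implyP := c_ok u.
by apply/forallP=> v; apply/implyP; apply: c_ok.
Qed.

Lemma colouringP c u v : adj u v -> val c u != val c v.
Proof. by move: u v; apply/proper_colouringP; apply: valP. Qed.

Definition colours c : {set 'I_k} := [set val c v | v in [set: G]].

Lemma mem_colours c v : val c v \in colours c.
Proof. exact: imset_f. Qed.

Lemma card_colours c : #|colours c| <= #|G|.
Proof. by rewrite -cardsT leq_imset_card. Qed.

Definition recolours c x v := forall w, (val c w != val x w) = (w == v).

Definition recoloursb c x v := [set w | val c w != val x w] == [set v].

Lemma recoloursP c x v : reflect (recolours c x v) (recoloursb c x v).
Proof.
apply: (iffP eqP) => [cx w|cx]; first by rewrite -[RHS]in_set1 -cx inE.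
by apply/setP=> w; rewrite !inE.
Qed.

Definition frozen c v := forall x, ~ recolours c x v.

Lemma recolours_eq c x v w : recolours c x v -> w != v -> val x w = val c w.
Proof. by move=> cx nwv; apply/esym/eqP/negPn; rewrite cx. Qed.

Lemma recolours_neq c x v : recolours c x v -> val c v != val x v.
Proof. by move->. Qed.

Lemma recolours_uniq c x u v : recolours c x u -> recolours c x v -> u = v.
Proof. by move=> cu /(_ u); rewrite cu eqxx => /esym/eqP. Qed.

Lemma colouring_adjP c x :
  reflect (exists v, recolours c x v) (colouring_adj c x).
Proof.
by apply: (iffP cards1P) => -[v] => [/eqP|] /recoloursP => [|/eqP]; exists v.
Qed.

Lemma recolours_same c x y v :
  recolours c x v -> recolours c y v -> x != y -> recolours x y v.
Proof.
move=> cx cy nxy w; have [->|nwv] := eqVneq w v; last first.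
  by rewrite (recolours_eq cx nwv) (recolours_eq cy nwv) eqxx.
apply: contraNneq nxy => exy; apply/eqP/val_inj/ffunP=> t.
have [->//|ntv] := eqVneq t v.
by rewrite (recolours_eq cx ntv) (recolours_eq cy ntv).
Qed.

(** The colourings [x] and [y] disagree at both [u] and [v], one vertex too many for an edge. *)
Lemma recolours_diff c x y u v :
  recolours c x u -> recolours c y v -> u != v ->
  x != y /\ ~~ colouring_adj x y.
Proof.
move=> cx cy nuv.
have xyu : val x u != val y u.
  by rewrite (recolours_eq cy nuv) eq_sym; apply: recolours_neq cx.
have xyv : val x v != val y v.
  by rewrite (recolours_eq cx) ?(recolours_neq cy) // eq_sym.
split; first by apply: contraNneq xyu => ->.
apply/colouring_adjP=> -[w xy]; move: nuv.
by rewrite xy in xyu; rewrite xy in xyv; rewrite (eqP xyu) (eqP xyv) eqxx.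
Qed.

Lemma recolouring c v a :
  a != val c v -> (forall w, adj w v -> val c w != a) ->
  exists2 x, recolours c x v & val x v = a.
Proof.
move=> nav free; pose g := [ffun w => if w == v then a else val c w].
have g_ok : proper_colouring g.
  apply/proper_colouringP=> s t; rewrite !ffunE.
  have [->|ns] := eqVneq s v; have [->|nt] := eqVneq t v => st.
  - by rewrite adj_irrefl in st.
  - by rewrite eq_sym free // adj_sym.
  - exact: free.
  - exact: colouringP.
exists (exist _ g g_ok : colouring G k); last by rewrite ffunE eqxx.
move=> w; rewrite ffunE; have [->|_] := eqVneq w v; last by rewrite eqxx.
by rewrite eq_sym.
Qed.

Lemma recolouring_fresh c v a :
  a \notin colours c -> exists2 x, recolours c x v & val x v = a.
Proof.
move=> fresh; apply: recolouring => [|w _].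
  by apply: contraNneq fresh => ->; apply: mem_colours.
by apply: contraNneq fresh => <-; apply: mem_colours.
Qed.

Lemma exists_fresh_colour c : #|G| < k -> exists a, a \notin colours c.
Proof.
by move=> ltGk; apply: exists_notin; rewrite card_ord; apply: leq_ltn_trans ltGk; apply: card_colours.
Qed.

Lemma not_frozen c v : #|G| < k -> exists x, recolours c x v.
Proof.
by case/(exists_fresh_colour c)=> a /(recolouring_fresh v) [x]; exists x.
Qed.

(** Recolour the same vertex once more, avoiding the colours of [x] and the one [y] introduces;
    hence the bound. *)
Lemma colouring_adj_triangle x y :
  #|G|.+1 < k -> colouring_adj x y ->
  exists2 z, colouring_adj x z & colouring_adj y z.
Proof.
move=> ltGk /colouring_adjP [v xy].
have [|a] := @exists_notin _ (val y v |: colours x).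
  rewrite card_ord cardsU1; apply: leq_ltn_trans ltGk.
  by apply: leq_add (leq_b1 _) (card_colours x).
rewrite !inE negb_or => /andP [nay /(recolouring_fresh v) [z xz zv]].
exists z; apply/colouring_adjP; exists v => //.
by apply: recolours_same xy xz _; apply: contraNneq nay => ->; rewrite zv.
Qed.

(** * Detecting edges through common neighbours *)

Definition only_common_neighbour c x y :=
  forall z, colouring_adj x z -> colouring_adj y z -> z = c.

(** If [u] and [v] were not adjacent, making both changes at once would be proper and give a common
    neighbour other than [c]. *)
Lemma only_common_neighbour_adj c x y u v :
  recolours c x u -> recolours c y v -> u != v ->
  only_common_neighbour c x y -> adj u v.
Proof.
move=> cx cy nuv only; apply/negPn/negP=> nadj.
have [||z xz zv] := @recolouring x v (val y v).
- by rewrite (recolours_eq cx) 1?eq_sym // recolours_neq.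
- move=> w wv; have nwu : w != u by apply: contraNneq nadj => <-.
  have nwv : w != v by apply: contraTneq wv => ->; rewrite adj_irrefl.
  by rewrite (recolours_eq cx nwu) -(recolours_eq cy nwv) colouringP.
have zu : val z u = val x u by apply: recolours_eq xz nuv.
have zc : z = c.
  apply: only; apply/colouring_adjP; first by exists v.
  exists u => w; have [->|nwv] := eqVneq w v.
    by rewrite zv eqxx eq_sym (negPf nuv).
  by rewrite (recolours_eq xz nwv) (recolours_eq cy nwv) cx.
by have := recolours_neq cx; rewrite -zu zc eqxx.
Qed.

Lemma adj_only_common_neighbour c u v :
  #|G| < k -> adj u v ->
  exists x y, [/\ recolours c x u, recolours c y v & only_common_neighbour c x y].
Proof.
move=> ltGk uv; have [a fresh] := exists_fresh_colour c ltGk.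
have nuv : u != v by apply: contraTneq uv => ->; rewrite adj_irrefl.
have [x cx xu] := recolouring_fresh u fresh.
have [y cy yv] := recolouring_fresh v fresh.
exists x, y; split=> // z /colouring_adjP [p xz] /colouring_adjP [q yz].
have xv : val x v = val c v by apply: recolours_eq cx _; rewrite eq_sym.
have yu : val y u = val c u by apply: recolours_eq cy nuv.
have nac w : val c w != a by apply: contraNneq fresh => <-; apply: mem_colours.
have upq : (u == p) || (u == q).
  rewrite -xz -yz xu yu; have := nac u.
  by case: (a =P val z u) => [<-|//].
have vpq : (v == p) || (v == q).
  rewrite -xz -yz xv yv; have := nac v.
  by case: (val c v =P val z v) => [<-|//]; rewrite eq_sym.
(* If [u] is not [p], then [z] keeps [a] from [x] at [u] and from [y] at [v], a clash; otherwise [z]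
   undoes the change at [u]. *)
have [eup|nup] := eqVneq u p; last first.
  have evp : v = p.
    apply/eqP; case/orP: vpq => // /eqP evq.
    by move: upq nuv; rewrite (negPf nup) evq => /= ->.
  have euq : u = q by apply/eqP; move: upq; rewrite (negPf nup).
  have := colouringP z uv.
  rewrite (recolours_eq xz) -?evp // (recolours_eq yz) -?euq 1?eq_sym //.
  by rewrite xu yv eqxx.
have evq : v = q.
  by apply/eqP; case/orP: vpq => // /eqP evp; rewrite eup evp eqxx in nuv.
apply/val_inj/ffunP=> w; have [->|nwu] := eqVneq w u.
  by rewrite (recolours_eq yz) // -evq.
by rewrite (recolours_eq xz) -?eup // (recolours_eq cx).
Qed.

(** * Propagation of frozen vertices *)

(** The triangle property is assumed rather than derived from a bound on [#|G|], since it will be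
    transported through an isomorphism. *)
Lemma frozen_adj x y v :
  (forall y z, colouring_adj y z -> exists2 t, colouring_adj y t & colouring_adj z t) ->
  colouring_adj x y -> frozen x v -> frozen y v /\ val y v = val x v.
Proof.
move=> triangle /colouring_adjP [w xy] frx.
have nvw : v != w by apply/eqP=> evw; apply: (frx y); rewrite evw.
have yv : val y v = val x v := recolours_eq xy nvw.
split=> // z yz.
have [|t /colouring_adjP[p yt] zt] := triangle y z.
  by apply/colouring_adjP; exists v.
have epv : p = v.
  apply/eqP/negPn/negP=> npv; have [_] := recolours_diff yt yz npv.
  by rewrite colouring_adj_sym zt.
rewrite {p}epv in yt.
have nzt : val z v != val t v.
  case/colouring_adjP: zt => p zt; rewrite zt; apply/eqP.
  have := recolours_same yz yt.
  have nzt : z != t.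
    by apply/eqP=> ezt; have := zt p; rewrite ezt !eqxx.
  by move=> /(_ nzt) zt'; apply: recolours_uniq zt' zt.
(* One of the two new colours of [v] avoids [val x w]; as [x] and [y] agree off [w], it is available
   at [v] already in [x]. *)
have [s ys nsx] : exists2 s, recolours y s v & val s v != val x w.
  have [ezx|] := eqVneq (val z v) (val x w); last by exists z.
  by exists t; rewrite // -ezx eq_sym.
have [||r xr _] := @recolouring x v (val s v); last exact: frx xr.
  by rewrite -yv eq_sym recolours_neq.
move=> u uv; have [->|nuw] := eqVneq u w; first by rewrite eq_sym.
have nuv : u != v by apply: contraTneq uv => ->; rewrite adj_irrefl.
by rewrite -(recolours_eq xy nuw) -(recolours_eq ys nuv) colouringP.
Qed.

(** * Connectivity of the colouring graph *)

Lemma connect_fresh c d :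
  injective (val d) -> (forall v, val d v \notin colours c) ->
  connect (@colouring_adj G k) c d.
Proof.
move=> d_inj fresh.
have main (s : seq G) : exists2 x, connect (@colouring_adj G k) c x &
    forall v, val x v = if v \in s then val d v else val c v.
  elim: s => [|u s [x cx xE]]; first by exists c; rewrite ?connect0.
  have [us|nus] := boolP (u \in s).
    exists x => // v; rewrite inE xE.
    by case: eqVneq => //= ->; rewrite us.
  have [||y xy yu] := @recolouring x u (val d u).
  - by rewrite xE (negPf nus); apply: contraNneq (fresh u) => ->; apply: mem_colours.
  - move=> w wu; rewrite xE; case: ifP => _; first exact: colouringP.
    by apply: contraNneq (fresh u) => <-; apply: mem_colours.
  exists y.
    by apply: connect_trans cx (connect1 _); apply/colouring_adjP; exists u.
  move=> v; rewrite inE; case: eqVneq => [->//|nvu] /=.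
  by rewrite (recolours_eq xy nvu).
have [x cx xE] := main (enum G).
by rewrite (_ : d = x) //; apply/val_inj/ffunP=> v; rewrite xE mem_enum.
Qed.

Lemma exists_colouring (f : G -> 'I_k) :
  injective f -> exists c, forall v, val c v = f v.
Proof.
move=> f_inj; have f_ok : proper_colouring (finfun f).
  apply/proper_colouringP=> u v uv; rewrite !ffunE.
  by apply: contraTneq uv => /f_inj ->; rewrite adj_irrefl.
by exists (exist _ (finfun f) f_ok : colouring G k) => v; rewrite ffunE.
Qed.

(** Pass through an injective colouring avoiding the colours of both ends, at most [#|G|] for
    each. *)
Lemma colouring_connected c d :
  3 * #|G| <= k -> connect (@colouring_adj G k) c d.
Proof.
move=> le3k; have [|f f_inj fcd] := @exists_injection_notin G _ (colours c :|: colours d).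
  rewrite card_ord; apply: leq_trans le3k; rewrite mulSn addnC leq_add2l mul2n -addnn.
  apply: leq_trans (leq_card_setU _ _) _.
  by apply: leq_add; apply: card_colours.
have [e eE] := exists_colouring f_inj.
have e_inj : injective (val e) by move=> u v; rewrite !eE => /f_inj.
have ce : connect (@colouring_adj G k) c e.
  by apply: connect_fresh => // v; have := fcd v; rewrite eE inE => /norP [].
have de : connect (@colouring_adj G k) d e.
  by apply: connect_fresh => // v; have := fcd v; rewrite eE inE => /norP [].
apply: connect_trans ce _.
by rewrite (sym_connect_sym (@colouring_adj_sym G k)).
Qed.

Lemma exists_colouring_neq c v :
  1 < k -> exists d, val d v != val c v.
Proof.
move=> lt1k; have [|b] := @exists_notin _ [set val c v]; first by rewrite cards1 card_ord.
rewrite inE => nbc; pose g := [ffun w => tperm (val c v) b (val c w)].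
have g_ok : proper_colouring g.
  apply/proper_colouringP=> s t st; rewrite !ffunE (inj_eq perm_inj).
  exact: colouringP.
by exists (exist _ g g_ok : colouring G k); rewrite ffunE tpermL.
Qed.

End Recolouring.

(** * Transport between colouring graphs *)

Section ColouringGraphIso.

Variables (G H : sgraph) (k : nat).
Variable phi : colouring G k -> colouring H k.
Hypothesis phi_inj : injective phi.
Hypothesis phi_adj : forall x y, colouring_adj (phi x) (phi y) = colouring_adj x y.

(** Neighbours of [c] recolouring [v] form a clique, so their images all recolour one vertex [f v];
    neighbours recolouring different vertices are not adjacent, so [f] is injective. *)
Lemma vertex_map (c : colouring G k) :
  (forall v, exists x, recolours c x v) ->
  exists2 f : G -> H, injective f &
    forall x v, recolours c x v -> recolours (phi c) (phi x) (f v).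
Proof.
move=> free.
have rec_phi v : exists w, [exists x : colouring G k,
    recoloursb c x v && recoloursb (phi c) (phi x) w].
  have [x cx] := free v.
  have /colouring_adjP [w cw] : colouring_adj (phi c) (phi x).
    by rewrite phi_adj; apply/colouring_adjP; exists v.
  by exists w; apply/existsP; exists x; apply/andP; split; apply/recoloursP.
pose f v := xchoose (rec_phi v).
have fP v : exists2 x, recolours c x v & recolours (phi c) (phi x) (f v).
  have /existsP[x /andP[/recoloursP cx /recoloursP cf]] := xchooseP (rec_phi v).
  by exists x.
exists f => [u v efuv|x v cx].
  have [x cx fx] := fP u; have [y cy fy] := fP v; rewrite -efuv in fy.
  apply/eqP/negPn/negP=> nuv.
  have [nxy /negP[]] := recolours_diff cx cy nuv.
  rewrite -phi_adj; apply/colouring_adjP; exists (f u).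
  by apply: recolours_same fx fy _; rewrite (inj_eq phi_inj).
have [y cy fy] := fP v.
have [->//|nxy] := eqVneq x y.
have /colouring_adjP [w fx] : colouring_adj (phi c) (phi x).
  by rewrite phi_adj; apply/colouring_adjP; exists v.
have [<-//|nwf] := eqVneq w (f v).
have [_ /negP[]] := recolours_diff fx fy nwf.
by rewrite phi_adj; apply/colouring_adjP; exists v; apply: recolours_same cx cy nxy.
Qed.

(** Since [psi] pulls every common neighbour back, [phi] preserves [only_common_neighbour], which
    detects edges. *)
Lemma vertex_map_adj (psi : colouring H k -> colouring G k)
    (c : colouring G k) (f : G -> H) :
  cancel psi phi -> #|G| < k -> injective f ->
  (forall x v, recolours c x v -> recolours (phi c) (phi x) (f v)) ->
  forall u v, adj u v -> adj (f u) (f v).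
Proof.
move=> psiK ltGk f_inj fP u v uv.
have [x [y [cx cy only]]] := adj_only_common_neighbour c ltGk uv.
apply: (only_common_neighbour_adj (fP _ _ cx) (fP _ _ cy)).
  by rewrite (inj_eq f_inj); apply: contraTneq uv => ->; rewrite adj_irrefl.
move=> z; rewrite -[z]psiK !phi_adj => xz yz.
by rewrite (only _ xz yz).
Qed.

(** The bound concerns [H]: triangles and paths found there are pulled back by [psi], and carry a
    frozen vertex with its colour from [c] to a colouring [d] that disagrees at it. *)
Lemma iso_not_frozen (psi : colouring H k -> colouring G k)
    (c : colouring G k) (v : G) :
  cancel phi psi -> cancel psi phi -> 0 < #|H| -> 3 * #|H| <= k ->
  exists x, recolours c x v.
Proof.
move=> phiK psiK H_gt0 le3k.
have triangle (y z : colouring G k) : colouring_adj y z ->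
    exists2 t, colouring_adj y t & colouring_adj z t.
  rewrite -phi_adj => /colouring_adj_triangle [|t yt zt]; first lia.
  by exists (psi t); rewrite -phi_adj psiK.
have [|nex] := boolP [exists x : colouring G k, recoloursb c x v].
  by case/existsP=> x /recoloursP; exists x.
have frc : frozen c v.
  by move=> x /recoloursP cx; case/existsP: nex; exists x.
have [|d ndc] := @exists_colouring_neq G k c v; first lia.
have /connectP [p] := colouring_connected (phi c) (phi d) le3k.
suff walk q y : frozen y v -> path (@colouring_adj H k) (phi y) q ->
    val (psi (last (phi y) q)) v = val y v.
  move=> cp ed; have := walk p c frc cp.
  by rewrite -ed phiK => edc; rewrite edc eqxx in ndc.
elim: q y => [|z q IHq] y fry /=; first by rewrite phiK.
rewrite -[z]psiK phi_adj => /andP [yz zq].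
have [frz <-] := frozen_adj triangle yz fry.
exact: IHq.
Qed.

End ColouringGraphIso.

Theorem theorem4 (G : sgraph) (n k : nat) (hn : #|G| = n) (hn1 : 1 <= n)
    (hk : 5 * n ^ 2 < k) (G' : sgraph) (hG' : 1 <= #|G'|) :
  graph_iso (colouring_graph G' k) (colouring_graph G k) -> graph_iso G' G.
Proof.
case=> phi [psi phiK psiK] phi_adj.
have psi_adj x y : colouring_adj (psi x) (psi y) = colouring_adj x y.
  by rewrite -[RHS](congr2 _ (psiK x) (psiK y)); apply/esym/phi_adj.
have le3k : 3 * #|G| <= k by nia.
have ltGk : #|G| < k by lia.
have [|f0 f0_inj _] := @exists_injection_notin G 'I_k set0.
  by rewrite cards0 card_ord; lia.
have [c _] := exists_colouring f0_inj.
have free v : exists x, recolours (psi c) x v.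
  by apply: (iso_not_frozen phi_adj) phiK psiK _ le3k; lia.
have [f f_inj fP] := vertex_map (can_inj phiK) phi_adj free.
have ltG'k : #|G'| < k by have := leq_card f f_inj; lia.
have [g g_inj gP] :=
  vertex_map (can_inj psiK) psi_adj (fun v => not_frozen c v ltGk).
(* A neighbour [x] recolouring [v] is sent to one recolouring [f v] and back to itself, so it also
   recolours [g (f v)]. *)
have fK : cancel f g.
  move=> v; have [x cx] := free v.
  have := gP _ _ (_ : recolours c (phi x) (f v)).
  have := fP _ _ cx; rewrite psiK => cfx /(_ cfx); rewrite phiK => cgx.
  exact: recolours_uniq cgx cx.
have gK : cancel g f by move=> u; apply: g_inj; rewrite fK.
have f_adj := vertex_map_adj phi_adj psiK ltG'k f_inj fP.
have g_adj := vertex_map_adj psi_adj phiK ltGk g_inj gP.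
exists f; first by exists g.
move=> u v; apply/idP/idP; last exact: f_adj.
by move/g_adj; rewrite !fK.
Qed.
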